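(* For every $\varepsilon>0$ there exist positive integers $d_\varepsilon,N_\varepsilon$ such that for all integers $d\ge d_\varepsilon$, $N\ge N_\varepsilon$, and every point $\mathbf a\in\mathcal W(d,N)$, the proportion of triangles $(\mathbf a,\mathbf w_1,\mathbf w_2)$ with $\mathbf w_1,\mathbf w_2\in\mathcal W(d,N)$ for which $$\Bigl|\operatorname{dist}_d(\mathbf w_1,\mathbf w_2)-\tfrac{1}{\sqrt6}\Bigr|\le\varepsilon\quad\text{and}\quad\Bigl|\operatorname{dist}_d(\mathbf a,\mathbf w_j)-\sqrt{\tfrac1{12}+r_{\mathbf a}^2}\Bigr|\le\varepsilon\ \text{ for } j=1,2$$ is at least $1-\varepsilon$, where $r_{\mathbf a}=\operatorname{dist}_d(\mathbf a,\mathbf c)$.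
   Context: For integers $d,N\ge1$, $\mathcal W(d,N)=\{0,1,\dots,N\}^d$ is the set of lattice points of $[0,N]^d$ and $\mathbf c=(N/2,\dots,N/2)$ its center. The normalized distance is $\operatorname{dist}_d(\mathbf u,\mathbf v)=\frac{1}{\sqrt d\,N}\bigl(\sum_{j=1}^d(u_j-v_j)^2\bigr)^{1/2}$. Triangles are counted as pairs $(\mathbf w_1,\mathbf w_2)\in\mathcal W^2$ forming with $\mathbf a$ a triangle. *)

(* Defs.v *)
From HB Require Import structures.
From mathcomp Require Import all_boot all_order all_algebra.
From mathcomp Require Import reals.

Set Implicit Arguments.
Unset Strict Implicit.
Unset Printing Implicit Defensive.

Import Order.TTheory GRing.Theory Num.Theory.
Local Open Scope ring_scope.

Definition lattice_cube (d N : nat) : finType := {ffun 'I_d -> 'I_N.+1}.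

Section Geometry.
Variables (R : realType) (d N : nat).

(* The center need not be a lattice point, so lattice points are embedded in
   R^d and distances are defined there. *)
Definition pt (w : lattice_cube d N) : 'rV[R]_d := \row_j (w j : nat)%:R.

Definition center : 'rV[R]_d := const_mx (N%:R / 2%:R).

Definition ndist (u v : 'rV[R]_d) : R :=
  (Num.sqrt d%:R * N%:R)^-1 * Num.sqrt (\sum_j (u 0 j - v 0 j) ^+ 2).

(* Three points form a triangle when they are not collinear, that is, when the
   two edge vectors issuing from u are linearly independent. *)
Definition is_triangle (u v w : 'rV[R]_d) : bool :=
  row_free (col_mx (v - u) (w - u)).

Definition triangles (a : lattice_cube d N) :
    {set lattice_cube d N * lattice_cube d N} :=
  [set p | is_triangle (pt a) (pt p.1) (pt p.2)].

Definition typical_triangle (eps : R) (a w1 w2 : lattice_cube d N) : bool :=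
  let r := ndist (pt a) center in
  [&& `|ndist (pt w1) (pt w2) - 1 / Num.sqrt 6%:R| <= eps,
      `|ndist (pt a) (pt w1) - Num.sqrt (1 / 12%:R + r ^+ 2)| <= eps &
      `|ndist (pt a) (pt w2) - Num.sqrt (1 / 12%:R + r ^+ 2)| <= eps].

Definition typical_proportion (eps : R) (a : lattice_cube d N) : R :=
  #|[set p in triangles a | typical_triangle eps a p.1 p.2]|%:R
    / #|triangles a|%:R.

End Geometry.

(* Main.v *)
Require Import Defs.
From HB Require Import structures.
From mathcomp Require Import all_boot all_order all_algebra.
From mathcomp Require Import reals.
From mathcomp Require Import ring lra zify.

Import Order.TTheory GRing.Theory Num.Theory.
Local Open Scope ring_scope.

(** For a point [x] of the solid cube [0,N]^d, the squared distance from [x] to a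
    uniformly random lattice point is an average of [d] independent terms in
    [0,1], with mean [1/12 + 1/(6N) + r_x^2]; by Chebyshev's inequality it
    deviates from it by more than [delta] with probability at most
    [1/(d delta^2)].  Using this at [x = a] for [w1] and for [w2], at [x = w1]
    for [w2], and at the center for [w1] (so that [r_{w1}^2] is close to [1/12])
    controls the three sides, since [|sqrt s - sqrt t|^2 <= |s - t|].
    Degenerate pairs only change the denominator: once [w1 <> a], at most [N+1]
    points [w2] are collinear with [a] and [w1], so for [d >= 3] at least half of
    all pairs form a triangle with [a]. *)

(** * Counting pairs *)

Lemma card_pairs (S T : finType) (A : S -> {set T}) :
  #|[set p : S * T | p.2 \in A p.1]| = (\sum_x #|A x|)%N.
Proof.
rewrite -sum1_card (eq_bigr (fun x => \sum_(y in A x) 1)%N); last first.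
  by move=> x _; rewrite sum1_card.
by rewrite pair_big_dep /=; apply: eq_bigl => p; rewrite inE.
Qed.

Lemma card_pairs_fst (S T : finType) (A : {set S}) :
  #|[set p : S * T | p.1 \in A]| = (#|A| * #|T|)%N.
Proof.
rewrite -cardsT -cardsX; apply: eq_card => p.
by rewrite !inE andbT.
Qed.

Lemma card_pairs_snd (S T : finType) (A : {set T}) :
  #|[set p : S * T | p.2 \in A]| = (#|S| * #|A|)%N.
Proof. by rewrite card_pairs sum_nat_const. Qed.

(** * Second moments and Chebyshev's inequality *)

Section SecondMoment.
Variables (R : realFieldType) (I S : finType) (f : I -> S -> R).
Hypothesis mean0 : forall i, \sum_s f i s = 0.

(** Distinct coordinates of [w] are independent: with factors 1 at the other coordinates, the sum
    over functions becomes a product of coordinate sums, and the one at [i] is 0. *)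
Lemma sum_ffun_cross (i j : I) : i != j ->
  \sum_(w : {ffun I -> S}) f i (w i) * f j (w j) = 0.
Proof.
move=> neq_ij.
pose F k s := if k == i then f i s else if k == j then f j s else 1.
rewrite (eq_bigr (fun w : {ffun I -> S} => \prod_k F k (w k))); last first.
  move=> w _; rewrite (bigD1 i) //= (bigD1 j) 1?eq_sym //= /F eqxx eqxx.
  rewrite eq_sym (negbTE neq_ij) big1 ?mulr1 // => k /andP[ki kj].
  by rewrite (negbTE ki) (negbTE kj).
rewrite -bigA_distr_bigA (bigD1 i) //= /F eqxx.
by rewrite (eq_bigr (f i)) // mean0 mul0r.
Qed.

(** After expanding the square, only the [#|I|] diagonal terms survive. *)
Lemma sum_ffun_sqr_le (B : R) : (forall i s, f i s ^+ 2 <= B) ->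
  \sum_(w : {ffun I -> S}) (\sum_i f i (w i)) ^+ 2
    <= #|I|%:R * #|{ffun I -> S}|%:R * B.
Proof.
move=> fB.
rewrite (eq_bigr (fun w : {ffun I -> S} =>
    \sum_i \sum_j f i (w i) * f j (w j))); last first.
  by move=> w _; rewrite expr2 mulr_suml; apply: eq_bigr => i _; rewrite mulr_sumr.
rewrite exchange_big /=.
have -> : #|I|%:R * #|{ffun I -> S}|%:R * B
    = \sum_(i : I) \sum_(w : {ffun I -> S}) B.
  by rewrite !sumr_const -mulrA !mulr_natl.
apply: ler_sum => i _; rewrite exchange_big (bigD1 i) //= [X in _ + X]big1.
  by rewrite addr0; apply: ler_sum => w _; rewrite -expr2.
by move=> j ji; apply: sum_ffun_cross; rewrite eq_sym.
Qed.

End SecondMoment.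

Lemma card_chebyshev (R : realFieldType) (T : finType) (g : T -> R) (t : R) :
  0 < t -> #|[set w | t < `|g w|]|%:R * t ^+ 2 <= \sum_w g w ^+ 2.
Proof.
move=> t0; rewrite mulr_natl -sumr_const.
rewrite [leRHS](bigID [in [set w | t < `|g w|]]) /=.
rewrite -[leLHS]addr0; apply: lerD; last by apply: sumr_ge0 => w _; exact: sqr_ge0.
apply: ler_sum => w; rewrite inE => tw.
rewrite -(real_normK (num_real (g w))); apply: lerXn2r; rewrite ?nnegrE //; exact: ltW.
Qed.

(** Variance plus squared bias: N(N+2)/12 is the variance of the uniform law on {0,...,N}, and N/2
    its mean. *)
Lemma sum_sqr_dist (R : realFieldType) (N : nat) (x : R) :
  \sum_(k < N.+1) (k%:R - x) ^+ 2
    = N.+1%:R * (N%:R * (N%:R + 2) / 12 + (x - N%:R / 2) ^+ 2).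
Proof.
elim: N => [|N IH]; first by rewrite big_ord1 /=; field.
by rewrite big_ord_recr /= IH -!natr1; field.
Qed.

Lemma sqrt_dist_le (R : rcfType) (x y e : R) : 0 <= x -> 0 <= y -> 0 <= e ->
  `|x - y| <= e ^+ 2 -> `|Num.sqrt x - Num.sqrt y| <= e.
Proof.
move=> x0 y0 e0.
rewrite -{1}(sqr_sqrtr x0) -{1}(sqr_sqrtr y0).
have := sqrtr_ge0 x; have := sqrtr_ge0 y.
move: (Num.sqrt x) (Num.sqrt y) => u v v0 u0.
rewrite !ler_norml => /andP[h1 h2]; apply/andP; split.
  (* If [u] and [v] differ by more than [e], so does their sum from 0, hence their squares differ by
     more than [e ^+ 2]. *)
  rewrite leNgt; apply/negP => h; nra.
rewrite leNgt; apply/negP => h; nra.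
Qed.

(** * Concentration of distances from a fixed point *)

Section Cube.
Variables (R : realType) (d N : nat).
Hypotheses (d_gt0 : (0 < d)%N) (N_gt0 : (0 < N)%N).

Local Notation T := (lattice_cube d N).
Local Notation M := (#|{: T}|).

Lemma ndist_ge0 (u v : 'rV[R]_d) : 0 <= ndist N u v.
Proof. by rewrite mulr_ge0 ?invr_ge0 ?mulr_ge0 ?sqrtr_ge0. Qed.

Lemma ndist_sqr (u v : 'rV[R]_d) :
  ndist N u v ^+ 2 = (\sum_j (u 0 j - v 0 j) ^+ 2) / (d%:R * N%:R ^+ 2).
Proof.
rewrite exprMn exprVn exprMn !sqr_sqrtr ?ler0n 1?mulrC //.
by apply: sumr_ge0 => j _; exact: sqr_ge0.
Qed.

Definition mean_sqr (x : 'rV[R]_d) : R :=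
  1 / 12 + 1 / (6 * N%:R) + ndist N x (center R d N) ^+ 2.

Definition atypical (delta : R) (x : 'rV[R]_d) : {set T} :=
  [set w | delta < `|ndist N x (pt R w) ^+ 2 - mean_sqr x|].

Lemma card_atypical (delta : R) (x : 'rV[R]_d) : 0 < delta ->
  (forall j, 0 <= x 0 j <= N%:R) ->
  #|atypical delta x|%:R * (delta ^+ 2 * d%:R) <= M%:R.
Proof.
move=> delta0 xN.
have d0 : 0 < d%:R :> R by rewrite ltr0n.
have N1 : 1 <= N%:R :> R by rewrite ler1n.
have N0 : 0 < N%:R :> R by rewrite ltr0n.
pose m j : R := N%:R * (N%:R + 2) / 12 + (x 0 j - N%:R / 2) ^+ 2.
pose f j (s : 'I_N.+1) := (s%:R - x 0 j) ^+ 2 - m j.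
have mean0 j : \sum_s f j s = 0.
  by rewrite big_split /= sum_sqr_dist sumr_const card_ord -(mulr_natr (- m j)) /m; ring.
(* Both the squared difference and its mean [m j] lie in [0,N^2]; the latter uses N >= 1. *)
have f_le j s : f j s ^+ 2 <= N%:R ^+ 4.
  have /andP[x0 x1] := xN j.
  have s0 : 0 <= s%:R :> R by rewrite ler0n.
  have s1 : s%:R <= N%:R :> R by rewrite ler_nat -ltnS.
  have -> : N%:R ^+ 4 = (N%:R ^+ 2) ^+ 2 :> R by ring.
  rewrite -(real_normK (num_real (f j s))) lerXn2r ?nnegrE ?sqr_ge0 //.
  have q1 : (s%:R - x 0 j) ^+ 2 <= N%:R ^+ 2 by nra.
  have q2 : 0 <= (s%:R - x 0 j) ^+ 2 by exact: sqr_ge0.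
  have m0 : 0 <= m j by rewrite addr_ge0 ?sqr_ge0 // divr_ge0 ?mulr_ge0 //; lra.
  have m1 : m j <= N%:R ^+ 2 by rewrite /m; nra.
  rewrite ler_norml /f; lra.
have sumE (w : T) : ndist N x (pt R w) ^+ 2 - mean_sqr x
    = (\sum_j f j (w j)) / (d%:R * N%:R ^+ 2).
  rewrite /mean_sqr !ndist_sqr /f /m sumrB big_split /= sumr_const card_ord.
  rewrite -mulr_natr.
  under [in RHS]eq_bigr do rewrite -sqrrN opprB.
  under [\sum_j (x 0 j - pt R w 0 j) ^+ 2]eq_bigr do rewrite mxE.
  under [\sum_j (x 0 j - center R d N 0 j) ^+ 2]eq_bigr do rewrite mxE.
  by field; lra.
have t0 : 0 < delta * (d%:R * N%:R ^+ 2) by rewrite !mulr_gt0 // exprn_gt0.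
have -> : atypical delta x
    = [set w : T | delta * (d%:R * N%:R ^+ 2) < `|\sum_j f j (w j)|].
  apply/setP => w; rewrite !inE sumE normrM normfV.
  have q0 : 0 < d%:R * N%:R ^+ 2 :> R by rewrite mulr_gt0 // exprn_gt0.
  by rewrite (gtr0_norm q0) ltr_pdivlMr.
have h1 := @card_chebyshev R T (fun w => \sum_j f j (w j)) _ t0.
have h2 := @sum_ffun_sqr_le R _ _ f mean0 _ f_le.
have h := le_trans h1 h2.
rewrite card_ord in h.
(* The common factor d N^4 of the Chebyshev threshold squared and the second moment bound
   cancels. *)
have K0 : 0 < d%:R * N%:R ^+ 4 :> R by rewrite mulr_gt0 // exprn_gt0.
by rewrite -(ler_pM2r K0); apply: etrans h; congr (_ <= _); ring.
Qed.

Lemma pt_bounds (w : T) j : 0 <= pt R w 0 j <= N%:R.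
Proof. by rewrite mxE ler0n ler_nat -ltnS /=. Qed.

Lemma center_bounds j : 0 <= center R d N 0 j <= N%:R.
Proof.
by have N0 : 0 <= N%:R :> R by []; rewrite mxE; lra.
Qed.

(** * Degenerate triangles *)

Lemma not_triangleP (u v w : 'rV[R]_d) : ~~ is_triangle u v w ->
  exists x y : R, ((x != 0) || (y != 0)) /\
    forall j, x * (v 0 j - u 0 j) + y * (w 0 j - u 0 j) = 0.
Proof.
rewrite /is_triangle -kermx_eq0 => /rowV0Pn[z /sub_kermxP].
rewrite -[z]hsubmxK mul_row_col => zE nz.
exists (lsubmx z 0 0), (rsubmx z 0 0); split.
  rewrite -negb_and; apply: contra nz => /andP[/eqP l0 /eqP r0].
  apply/eqP; rewrite [lsubmx z]mx11_scalar [rsubmx z]mx11_scalar l0 r0.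
  by rewrite !raddf0 row_mx0.
move=> j; move/matrixP/(_ 0 j): zE.
by rewrite !mxE !big_ord1 !mxE.
Qed.

(* A point collinear with [a] and [w1] is determined by any of its coordinates in
   which [a] and [w1] differ. *)
Lemma card_collinear_le (a w1 : T) : w1 != a ->
  (#|[set w2 : T | ~~ is_triangle (pt R a) (pt R w1) (pt R w2)]| <= N.+1)%N.
Proof.
move=> neq.
have [j wj] : exists j, w1 j != a j.
  apply/existsP; rewrite -negb_forall; apply: contra neq => /forallP h.
  by apply/eqP/ffunP => j; apply/eqP.
have wjR : pt R w1 0 j - pt R a 0 j != 0.
  by rewrite subr_eq0 !mxE eqr_nat; exact: wj.
rewrite -[leqRHS]card_ord; apply: (@leq_card_in _ _ (fun w : T => w j)).
move=> v w; rewrite !inE => /not_triangleP[x [y [xy E]]] /not_triangleP[x' [y' [xy' E']]] vw.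
(* With [t = 0], the relation at coordinate [j], where [w1] and [a] differ, would force [s = 0] as
   well. *)
have ne0 (s t : R) (z : T) : (s != 0) || (t != 0) ->
   (forall j, s * (pt R w1 0 j - pt R a 0 j) + t * (pt R z 0 j - pt R a 0 j) = 0) ->
   t != 0.
  move=> st /(_ j) Ej; apply/eqP => t0; move: st Ej.
  rewrite t0 eqxx orbF mul0r addr0 => s0 /eqP.
  by rewrite mulf_eq0 (negbTE s0) (negbTE wjR).
have y0 := ne0 _ _ _ xy E; have y0' := ne0 _ _ _ xy' E'.
have solve (s t p q : R) : t != 0 -> s * p + t * q = 0 -> q = - (s / t) * p.
  move=> t0 e; apply: (mulfI t0); rewrite -[LHS](addKr (s * p)) e; field; exact: t0.
(* Agreement at [j] fixes the position along the line through [a] and [w1], hence all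
   coordinates. *)
have ratio : - (x / y) = - (x' / y').
  apply: (mulIf wjR); rewrite -(solve _ _ _ _ y0 (E j)) -(solve _ _ _ _ y0' (E' j)).
  by rewrite !mxE vw.
apply/ffunP => i; apply/val_inj/eqP.
rewrite -(eqr_nat R) -(inj_eq (addIr (- pt R a 0 i))); apply/eqP.
have := solve _ _ _ _ y0 (E i); have := solve _ _ _ _ y0' (E' i).
by rewrite ratio => <-; rewrite !mxE.
Qed.

(** N+2 = (N+1) + 1: each [w1 != a] contributes at most N+1 points, and [w1 = a] at most all M of
    them. *)
Lemma card_not_triangle (a : T) :
  (#|~: triangles R a| <= M * N.+2)%N.
Proof.
pose A (w1 : T) := [set w2 : T | ~~ is_triangle (pt R a) (pt R w1) (pt R w2)].
have -> : ~: triangles R a = [set p | p.2 \in A p.1].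
  by apply/setP => p; rewrite !inE.
rewrite card_pairs (bigD1 a) //= mulnS leq_add ?max_card //.
apply: leq_trans (_ : \sum_(i | i != a) N.+1 <= _)%N.
  by apply: leq_sum => w; exact: card_collinear_le.
by rewrite sum_nat_const leq_mul2r max_card orbT.
Qed.

Lemma card_triangles_ge (a : T) : (3 <= d)%N ->
  M%:R ^+ 2 / 2 <= #|triangles R a|%:R :> R.
Proof.
move=> d3.
have cM : M = (N.+1 ^ d)%N by rewrite card_ffun !card_ord.
(* At N = 1 this reads 6 <= 8, whereas the exponent 2 would fail. *)
have MN : (2 * N.+2 <= M)%N.
  rewrite cM; apply: leq_trans (_ : N.+1 ^ 3 <= _)%N; last by rewrite leq_exp2l.
  case: N N_gt0 => // n _; rewrite !expnS expn0; nia.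
have h := card_not_triangle a.
have := cardsC (triangles R a); rewrite card_prod => e.
have : (M * M <= 2 * #|triangles R a|)%N by nia.
rewrite -(ler_nat R) !natrM -expr2; lra.
Qed.

End Cube.

Arguments atypical {R d} N delta x.
Arguments card_triangles_ge R {d N}.

(** * From typical distances to typical triangles *)

Section Typical.
Variables (R : realType) (d N : nat) (eps : R).
Hypotheses (d_gt0 : (0 < d)%N) (N_gt0 : (0 < N)%N) (eps_gt0 : 0 < eps).
Hypothesis N_large : 1 / (6 * N%:R) <= eps ^+ 2 / 4.

Local Notation T := (lattice_cube d N).
Local Notation M := (#|{: T}|).
Local Notation delta := (eps ^+ 2 / 4).

Lemma ndist_center : ndist N (center R d N) (center R d N) = 0.
Proof.
rewrite /ndist big1 ?sqrtr0 ?mulr0 // => j _.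
by rewrite subrr expr0n.
Qed.

Lemma ndistC (u v : 'rV[R]_d) : ndist N u v = ndist N v u.
Proof.
by congr (_ * Num.sqrt _); apply: eq_bigr => j _; rewrite -sqrrN opprB.
Qed.

(** The side from [w1] to [w2] dictates [delta]: its squared length differs from 1/6 by at most two
    errors [delta] and two shifts 1/(6N), each at most eps^2/4. *)
Lemma typicalP (a w1 w2 : T) :
  w1 \notin atypical N delta (pt R a) -> w2 \notin atypical N delta (pt R a) ->
  w2 \notin atypical N delta (pt R w1) ->
  w1 \notin atypical N delta (center R d N) ->
  typical_triangle eps a w1 w2.
Proof.
rewrite !inE -!leNgt /mean_sqr ndist_center expr0n /= addr0 => h1 h2 h3 h4.
have e0 : 0 <= eps ^+ 2 by exact: sqr_ge0.
have inv0 : 0 <= 1 / (6 * N%:R) :> R by rewrite divr_ge0 ?mulr_ge0.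
have close (u v : 'rV[R]_d) s : 0 <= s -> `|ndist N u v ^+ 2 - s| <= eps ^+ 2 ->
    `|ndist N u v - Num.sqrt s| <= eps.
  move=> s0 h.
  rewrite -[ndist N u v](ger0_norm (ndist_ge0 _ _ _ _ _)) -(sqrtr_sqr (ndist N u v)).
  by apply: sqrt_dist_le; rewrite ?sqr_ge0 // ltW.
have r0 (u v : 'rV[R]_d) : 0 <= ndist N u v ^+ 2 by exact: sqr_ge0.
move: N_large inv0 h1 h2 h3 h4; set inv := 1 / (6 * N%:R) => inv1 inv0.
rewrite !ler_norml [ndist N (center R d N) _]ndistC.
move=> /andP[h1 h1'] /andP[h2 h2'] /andP[h3 h3'] /andP[h4 h4'].
apply/and3P; split.
- have -> : 1 / Num.sqrt 6 = Num.sqrt (1 / 6) :> R by rewrite !div1r sqrtrV.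
  apply: (close); first lra.
  by rewrite ler_norml; apply/andP; split; lra.
- apply: (close); first by have := r0 (pt R a) (center R d N); lra.
  by rewrite ler_norml; apply/andP; split; lra.
- apply: (close); first by have := r0 (pt R a) (center R d N); lra.
  by rewrite ler_norml; apply/andP; split; lra.
Qed.

Lemma card_atypical_pairs (a : T) :
  #|[set p : T * T | ~~ typical_triangle eps a p.1 p.2]|%:R
    * (delta ^+ 2 * d%:R) <= 4 * M%:R ^+ 2 :> R.
Proof.
pose B := atypical N delta : 'rV[R]_d -> {set T}.
have delta0 : 0 < delta by rewrite divr_gt0 // exprn_gt0.
have K0 : 0 <= delta ^+ 2 * d%:R by rewrite mulr_ge0 ?sqr_ge0.
have bB (x : 'rV[R]_d) : (forall j, 0 <= x 0 j <= N%:R) ->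
    #|B x|%:R * (delta ^+ 2 * d%:R) <= M%:R by exact: card_atypical.
have sub : [set p : T * T | ~~ typical_triangle eps a p.1 p.2]
  \subset [set p : T * T | p.1 \in B (pt R a)] :|: [set p : T * T | p.2 \in B (pt R a)]
     :|: [set p : T * T | p.2 \in B (pt R p.1)]
     :|: [set p : T * T | p.1 \in B (center R d N)].
  apply/subsetP => -[w1 w2]; rewrite !inE -/(B _) /=; apply: contraR.
  rewrite !negb_or -!andbA => /and4P[*].
  by apply: typicalP; rewrite inE.
have := subset_leq_card sub; rewrite -(ler_nat R) => h.
apply: le_trans (ler_wpM2r K0 h) _.
have cU (A C : {set T * T}) (x y : R) : #|A|%:R * (delta ^+ 2 * d%:R) <= x ->
   #|C|%:R * (delta ^+ 2 * d%:R) <= y -> #|A :|: C|%:R * (delta ^+ 2 * d%:R) <= x + y.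
  move=> hA hC; apply: le_trans (lerD hA hC); rewrite -mulrDl ler_wpM2r //.
  by rewrite -natrD ler_nat cardsU leq_subr.
have -> : 4 * M%:R ^+ 2 = M%:R ^+ 2 + M%:R ^+ 2 + M%:R ^+ 2 + M%:R ^+ 2 :> R by ring.
do 3?[apply: (cU)].
- rewrite card_pairs_fst natrM mulrAC expr2 ler_wpM2r //.
  by apply: bB; exact: pt_bounds.
- rewrite card_pairs_snd natrM -mulrA expr2 ler_wpM2l //.
  by apply: bB; exact: pt_bounds.
(* Here the center of concentration varies with [w1], so the bound is summed over [w1]. *)
- rewrite (card_pairs _ _ (fun w => B (pt R w))) natr_sum mulr_suml.
  apply: le_trans (_ : \sum_(w : T) M%:R <= _).
    by apply: ler_sum => w _; apply: bB; exact: pt_bounds.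
  by rewrite sumr_const -(mulr_natr M%:R) expr2.
- rewrite card_pairs_fst natrM mulrAC expr2 ler_wpM2r //.
  by apply: bB; exact: center_bounds.
Qed.

(** At most 64 M^2/(eps^4 d) pairs are atypical, and M^2 is at most twice the number of triangles,
    whence 128. *)
Lemma typical_proportion_ge (a : T) : (3 <= d)%N -> 128 <= eps ^+ 5 * d%:R ->
  1 - eps <= typical_proportion eps a.
Proof.
move=> d3 d_large.
have M0 : 0 < M%:R :> R by rewrite ltr0n; apply/card_gt0P; exists a.
have t_ge := card_triangles_ge R d_gt0 N_gt0 a d3.
have t0 : 0 < #|triangles R a|%:R :> R.
  by apply: lt_le_trans t_ge; rewrite divr_gt0 // exprn_gt0.
rewrite /typical_proportion ler_pdivlMr //.
have split : (#|triangles R a| <=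
   #|[set p in triangles R a | typical_triangle eps a p.1 p.2]|
   + #|[set p : T * T | ~~ typical_triangle eps a p.1 p.2]|)%N.
  apply: leq_trans (leq_card_setU _ _); apply: subset_leq_card.
  by apply/subsetP => p pt; rewrite !inE in pt *; rewrite pt /= orbN.
move: split; rewrite -(ler_nat R) natrD.
have := card_atypical_pairs a.
have d0 : 0 < d%:R :> R by rewrite ltr0n.
set b := #|[set p | ~~ _]|%:R; set t := #|triangles R a|%:R in t_ge *.
set s := #|_|%:R => hb hst.
suff : b <= eps * t by lra.
have K0 : 0 < delta ^+ 2 * d%:R by rewrite mulr_gt0 // exprn_gt0 // divr_gt0 // exprn_gt0.
rewrite -(ler_pM2r K0); apply: le_trans hb _.
apply: le_trans (_ : 8 * t <= _); first lra.
have -> : eps * t * (delta ^+ 2 * d%:R) = (eps ^+ 5 * d%:R) / 16 * t by field.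
by rewrite ler_pM2r //; lra.
Qed.

End Typical.

Theorem theorem1p3 (R : realType) (eps : R) (eps_gt0 : 0 < eps) :
  exists d_eps N_eps : nat,
    [/\ (0 < d_eps)%N, (0 < N_eps)%N &
      forall d N : nat, (d_eps <= d)%N -> (N_eps <= N)%N ->
      forall a : lattice_cube d N,
        1 - eps <= typical_proportion eps a].
Proof.
have e2 : 0 < eps ^+ 2 by rewrite exprn_gt0.
have e5 : 0 < eps ^+ 5 by rewrite exprn_gt0.
(* The 3 makes half of the pairs nondegenerate; N >= 1/eps^2 gives 1/(6N) <= eps^2/4. *)
exists (maxn 3 (Num.truncn (128 / eps ^+ 5)).+1), (Num.truncn (1 / eps ^+ 2)).+1.
split=> // [|d N]; first by rewrite leq_max.
rewrite geq_max => /andP[d3 dl] Nl a.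
have big (x : R) (n : nat) : (Num.truncn x < n)%N -> x <= n%:R.
  move=> xn; apply: ltW; apply: lt_le_trans (truncnS_gt _) _.
  by rewrite ler_nat.
have N0 : (0 < N)%N by exact: leq_ltn_trans Nl.
have N0R : 0 < N%:R :> R by rewrite ltr0n.
apply: typical_proportion_ge => //; first exact: leq_trans d3.
  have := big _ _ Nl; rewrite ler_pdivrMr // ler_pdivrMr ?mulr_gt0 //.
  nra.
by have := big _ _ dl; rewrite ler_pdivrMr // mulrC.
Qed.
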